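(* The map $f$ gives a one-to-one correspondence between $|-1|$-Hom-configurations in $\mathsf{T}_{-1}$ and noncrossing partitions of $\mathbb{Z}$ with at most one infinite block.
   Context: Let $K$ be an algebraically closed field, $w=-1$, $d=w-1=-2$. $\mathsf{T}=\mathsf{T}_{-1}$ denotes a $K$-linear idempotent complete algebraic triangulated category, with shift $\Sigma$, classically generated by a $(-1)$-spherical object, i.e. an object $s$ with $\dim_K\mathrm{Hom}(s,\Sigma^i s)=1$ if $i\in\{0,-1\}$ and $0$ otherwise. It is known that $\mathsf{T}$ is unique up to triangle equivalence, Krull–Schmidt with finite dimensional Hom-spaces, and $(-1)$-Calabi–Yau: $\mathrm{Hom}(x,y)\cong D\,\mathrm{Hom}(y,\Sigma^{-1}x)$ bifunctorially. Arc model. The vertices of the $\infty$-gon are the integers. An admissible arc is a pair $(t,u)$ of integers with $t>u$ and $t-u$ odd. Isomorphism classes of indecomposable objects of $\mathsf{T}$ are identified with admissible arcs in such a way that $\Sigma(t,u)=(t-1,u-1)$ and the arrows of the Auslander–Reiten quiver are $(t,u)\to(t,u-2)$ and $(t,u)\to(t-2,u)$ whenever the target is admissible (this fixes the identification up to powers of $\Sigma$; fix one such identification). Under it, for $x=(t,u)$ and $k:=\frac{t-u+1}{2}$, $\dim_K\mathrm{Hom}(x,y)=1$ if $y$ is an admissible arc of the form $(t-2i,v)$ with $0\le i\le k-1$, $v\le u$, or of the form $(z,u+1+2i)$ with $0\le i\le k-1$, $z\ge t+1$; otherwise $\mathrm{Hom}(x,y)=0$. A $|-1|$-Hom-configuration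 is a maximal Hom-free collection of indecomposable objects: a collection $\mathsf{H}$ of (isomorphism classes of) indecomposable objects such that, for every indecomposable $h$, one has $h\in\mathsf{H}$ if and only if $\mathrm{Hom}(x,\Sigma^i h)=0$ for all $x\in\mathsf{H}\setminus\{h\}$ and $i=0,-1$. A noncrossing partition of $\mathbb{Z}$ is a set of pairwise disjoint non-empty subsets (blocks) whose union is $\mathbb{Z}$, such that no two blocks cross; i.e. there are no distinct blocks $B,B'$ and $a<b<c<e$ with $a,c\in B$ and $b,e\in B'$. The map $f$. Let $\mathbb{Z}'$ be the copy of $\mathbb{Z}$ consisting of the points $n':=0.5+2n$, $n\in\mathbb{Z}$; it is identified with $\mathbb{Z}$ via $n'\leftrightarrow n$. For a $|-1|$-Hom-configuration $\mathsf{H}$, $f(\mathsf{H})$ is the partition of $\mathbb{Z}'$ whose blocks, with elements listed in increasing order, are determined as follows: given an element $n'$ of a block, if $\mathsf{H}$ contains an arc of the form $(m,n'+0.5)$, then the next element of the block after $n'$ is $m+0.5$; otherwise (if $n'+0.5$ is incident with an arc of $\mathsf{H}$ of the form $(n'+0.5,m)$, or is not incident with any arc of $\mathsf{H}$) $n'$ is the last element of its block. *)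

(* Defs.v *)
From mathcomp Require Import all_boot all_order all_algebra.
From mathcomp Require Import boolp classical_sets functions cardinality.
From mathcomp Require Import zify.

Set Implicit Arguments.
Unset Strict Implicit.
Unset Printing Implicit Defensive.

Import Order.TTheory GRing.Theory Num.Theory.
Local Open Scope classical_set_scope.
Local Open Scope ring_scope.

(** * K-linear categories *)

Record lincat (K : fieldType) := LinCat {
  ob :> Type;
  Hom : ob -> ob -> lmodType K;
  idm : forall x, Hom x x;
  comp : forall x y z, Hom y z -> Hom x y -> Hom x z;
  comp1m : forall x y (f : Hom x y), comp (idm y) f = f;
  compm1 : forall x y (f : Hom x y), comp f (idm x) = f;
  compA : forall x y z t (h : Hom z t) (g : Hom y z) (f : Hom x y),
    comp h (comp g f) = comp (comp h g) f;
  comp_linl : forall x y z (f : Hom x y),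
    linear (fun g : Hom y z => comp g f);
  comp_linr : forall x y z (g : Hom y z),
    linear (fun f : Hom x y => comp g f) }.

Arguments idm {K l} x.
Notation "g \oc f" := (comp g f) (at level 40, left associativity).

Record linfunctor (K : fieldType) (C D : lincat K) := LinFunctor {
  fob :> C -> D;
  fmor : forall x y, Hom x y -> Hom (fob x) (fob y);
  fmor_lin : forall x y, linear (@fmor x y);
  fmor1 : forall x, fmor (idm x) = idm (fob x);
  fmorM : forall x y z (g : Hom y z) (f : Hom x y),
    fmor (g \oc f) = fmor g \oc fmor f }.

Arguments fmor {K C D} l {x y}.

Definition has_dim (K : fieldType) (V : lmodType K) (n : nat) : Prop :=
  exists2 phi : V -> 'rV[K]_n, linear phi & bijective phi.

Section LinearCategories.
Context {K : fieldType} {C : lincat K}.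
Implicit Types x y z : C.

Definition isom x y (f : Hom x y) : Prop :=
  exists g : Hom y x, g \oc f = idm x /\ f \oc g = idm y.

Definition isomorphic x y : Prop := exists f : Hom x y, isom f.

Definition is_zero x : Prop := idm x = 0.

(* z is the direct sum of x and y *)
Definition is_biproduct x y z : Prop :=
  exists (i1 : Hom x z) (i2 : Hom y z) (p1 : Hom z x) (p2 : Hom z y),
    [/\ p1 \oc i1 = idm x, p2 \oc i2 = idm y &
        i1 \oc p1 + i2 \oc p2 = idm z].

Definition indecomposable x : Prop :=
  ~ is_zero x /\ forall y z, is_biproduct y z x -> is_zero y \/ is_zero z.

Definition split_mono x y (f : Hom x y) : Prop :=
  exists g : Hom y x, g \oc f = idm x.

Definition split_epi x y (f : Hom x y) : Prop :=
  exists g : Hom y x, f \oc g = idm y.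

Definition irreducible_mor x y (f : Hom x y) : Prop :=
  [/\ ~ split_mono f, ~ split_epi f &
      forall z (h : Hom x z) (g : Hom z y),
        f = g \oc h -> split_mono h \/ split_epi g].

End LinearCategories.

Definition additive_cat (K : fieldType) (C : lincat K) : Prop :=
  (exists o : C, is_zero o) /\
  (forall x y : C, exists z : C, is_biproduct x y z).

Definition idempotent_complete (K : fieldType) (C : lincat K) : Prop :=
  forall (x : C) (e : Hom x x), e \oc e = e ->
    exists (y : C) (p : Hom x y) (i : Hom y x), i \oc p = e /\ p \oc i = idm y.

(* a natural isomorphism from G after F to the identity *)
Definition left_quasi_inverse (K : fieldType) (C D : lincat K)
    (F : linfunctor C D) (G : linfunctor D C) : Prop :=
  exists eta : forall x : C, Hom (G (F x)) x,
    (forall x, isom (eta x)) /\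
    (forall (x y : C) (f : Hom x y),
       f \oc eta x = eta y \oc fmor G (fmor F f)).

(** * Triangulated categories *)

(* The shift is an autoequivalence with a chosen quasi-inverse. *)
Record triangulated (K : fieldType) := Triangulated {
  tcat :> lincat K;
  shift : linfunctor tcat tcat;
  unshift : linfunctor tcat tcat;
  dist : forall x y z : tcat,
    Hom x y -> Hom y z -> Hom z (shift x) -> Prop;
  tcat_additive : additive_cat tcat;
  shiftK : left_quasi_inverse shift unshift;
  unshiftK : left_quasi_inverse unshift shift;
  (* TR1 *)
  dist_id : forall x o : tcat, is_zero o ->
    dist (idm x) (0 : Hom x o) (0 : Hom o (shift x));
  dist_cone : forall (x y : tcat) (f : Hom x y),
    exists (z : tcat) (g : Hom y z) (h : Hom z (shift x)), dist f g h;
  dist_iso : forall (x y z x' y' z' : tcat)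
    (f : Hom x y) (g : Hom y z) (h : Hom z (shift x))
    (f' : Hom x' y') (g' : Hom y' z') (h' : Hom z' (shift x'))
    (a : Hom x x') (b : Hom y y') (c : Hom z z'),
    isom a -> isom b -> isom c ->
    b \oc f = f' \oc a -> c \oc g = g' \oc b ->
    fmor shift a \oc h = h' \oc c ->
    dist f g h -> dist f' g' h';
  (* TR2 *)
  dist_rot : forall (x y z : tcat)
    (f : Hom x y) (g : Hom y z) (h : Hom z (shift x)),
    dist f g h <-> dist g h (- fmor shift f);
  (* TR3 *)
  dist_mor : forall (x y z x' y' z' : tcat)
    (f : Hom x y) (g : Hom y z) (h : Hom z (shift x))
    (f' : Hom x' y') (g' : Hom y' z') (h' : Hom z' (shift x'))
    (a : Hom x x') (b : Hom y y'),
    dist f g h -> dist f' g' h' -> b \oc f = f' \oc a ->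
    exists c : Hom z z',
      c \oc g = g' \oc b /\ fmor shift a \oc h = h' \oc c;
  (* TR4, the octahedral axiom *)
  dist_octa : forall (x y z x' y' z' : tcat)
    (f : Hom x y) (j : Hom y z') (j' : Hom z' (shift x))
    (g : Hom y z) (l : Hom z x') (l' : Hom x' (shift y))
    (k : Hom z y') (k' : Hom y' (shift x)),
    dist f j j' -> dist g l l' -> dist (g \oc f) k k' ->
    exists (u : Hom z' y') (v : Hom y' x'),
      [/\ dist u v (fmor shift j \oc l'),
          u \oc j = k \oc g,
          k' \oc u = j',
          v \oc k = l &
          l' \oc v = fmor shift f \oc k'] }.

Arguments shift {K} t.
Arguments unshift {K} t.
Arguments dist {K t x y z}.

(* the i-fold shift, i an integer *)
Definition shiftz (K : fieldType) (T : triangulated K) (i : int) (x : T) : T :=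
  match i with
  | Posz n => iter n (shift T) x
  | Negz n => iter n.+1 (unshift T) x
  end.

Definition thick (K : fieldType) (T : triangulated K) (S : set T) : Prop :=
  [/\ forall x y : T, isomorphic x y -> S x -> S y,
      forall x : T, S x -> S (shift T x) /\ S (unshift T x),
      forall (x y z : T) (f : Hom x y) (g : Hom y z) (h : Hom z (shift T x)),
        dist f g h -> S x -> S y -> S z &
      forall x y z : T, is_biproduct x y z -> S z -> S x /\ S y].

Definition classically_generates (K : fieldType) (T : triangulated K) (s : T)
  : Prop := forall S : set T, thick S -> S s -> forall x : T, S x.

(** * Frobenius categories and algebraic triangulated categories *)

Section Exact.
Context {K : fieldType} {E : lincat K}.
Variable confl : forall x y z : E, Hom x y -> Hom y z -> Prop.

Definition kernel_cokernel_pair (x y z : E) (u : Hom x y) (v : Hom y z) : Prop :=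
  [/\ v \oc u = 0,
      forall (w : E) (h : Hom w y), v \oc h = 0 ->
        exists! k : Hom w x, u \oc k = h &
      forall (w : E) (h : Hom y w), h \oc u = 0 ->
        exists! k : Hom z w, k \oc v = h].

Definition inflation (x y : E) (u : Hom x y) : Prop :=
  exists (z : E) (v : Hom y z), confl u v.

Definition deflation (y z : E) (v : Hom y z) : Prop :=
  exists (x : E) (u : Hom x y), confl u v.

Definition is_pushout (x y x' y' : E) (u : Hom x y) (f : Hom x x')
    (f' : Hom y y') (u' : Hom x' y') : Prop :=
  f' \oc u = u' \oc f /\
  forall (w : E) (a : Hom y w) (b : Hom x' w), a \oc u = b \oc f ->
    exists! c : Hom y' w, c \oc f' = a /\ c \oc u' = b.

Definition is_pullback (y z y' z' : E) (v : Hom y z) (g : Hom z' z)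
    (g' : Hom y' y) (v' : Hom y' z') : Prop :=
  v \oc g' = g \oc v' /\
  forall (w : E) (a : Hom w y) (b : Hom w z'), v \oc a = g \oc b ->
    exists! c : Hom w y', g' \oc c = a /\ v' \oc c = b.

Record exact_structure : Prop := ExactStructure {
  exact_additive : additive_cat E;
  confl_kercok : forall (x y z : E) (u : Hom x y) (v : Hom y z),
    confl u v -> kernel_cokernel_pair u v;
  confl_iso : forall (x y z x' y' z' : E) (u : Hom x y) (v : Hom y z)
    (u' : Hom x' y') (v' : Hom y' z')
    (a : Hom x x') (b : Hom y y') (c : Hom z z'),
    isom a -> isom b -> isom c ->
    b \oc u = u' \oc a -> c \oc v = v' \oc b ->
    confl u v -> confl u' v';
  inflation_id : forall x : E, inflation (idm x);
  deflation_id : forall x : E, deflation (idm x);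
  inflation_comp : forall (x y z : E) (u : Hom x y) (u' : Hom y z),
    inflation u -> inflation u' -> inflation (u' \oc u);
  deflation_comp : forall (x y z : E) (v : Hom x y) (v' : Hom y z),
    deflation v -> deflation v' -> deflation (v' \oc v);
  inflation_pushout : forall (x y x' : E) (u : Hom x y) (f : Hom x x'),
    inflation u ->
    exists (y' : E) (f' : Hom y y') (u' : Hom x' y'),
      is_pushout u f f' u' /\ inflation u';
  deflation_pullback : forall (y z z' : E) (v : Hom y z) (g : Hom z' z),
    deflation v ->
    exists (y' : E) (g' : Hom y' y) (v' : Hom y' z'),
      is_pullback v g g' v' /\ deflation v' }.

Definition injective_ob (i : E) : Prop :=
  forall (x y : E) (u : Hom x y), inflation u ->
  forall f : Hom x i, exists g : Hom y i, g \oc u = f.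

Definition projective_ob (p : E) : Prop :=
  forall (y z : E) (v : Hom y z), deflation v ->
  forall f : Hom p z, exists g : Hom p y, v \oc g = f.

Record frobenius : Prop := Frobenius {
  frobenius_exact : exact_structure;
  enough_injectives : forall x : E,
    exists (i : E) (u : Hom x i), injective_ob i /\ inflation u;
  enough_projectives : forall x : E,
    exists (p : E) (v : Hom p x), projective_ob p /\ deflation v;
  injective_projective : forall x : E, injective_ob x <-> projective_ob x }.

Definition stably_zero (x y : E) (f : Hom x y) : Prop :=
  exists (p : E) (a : Hom x p) (b : Hom p y), projective_ob p /\ f = b \oc a.

End Exact.

(* T is triangle equivalent to the stable category of a K-linear Frobenius
   category E.  The equivalence is given by the functor pi that it induces on
   E.  A suspension of x in the stable category is the cokernel c of any
   inflation j of x into an injective object; theta is the isomorphism of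
   functors making pi a triangle functor, and the last clause says that pi
   preserves the standard triangles.  The sign convention for the latter is
   immaterial, as it can be absorbed in theta. *)
Definition algebraic (K : fieldType) (T : triangulated K) : Prop :=
  exists (E : lincat K) (confl : forall x y z : E, Hom x y -> Hom y z -> Prop)
    (pi : linfunctor E T)
    (theta : forall (x i c : E) (j : Hom x i) (p : Hom i c),
       Hom (pi c) (shift T (pi x))),
  [/\ frobenius confl,
      [/\ forall y : T, exists x : E, isomorphic (pi x) y,
          forall (x y : E) (g : Hom (pi x) (pi y)),
            exists f : Hom x y, fmor pi f = g &
          forall (x y : E) (f : Hom x y),
            fmor pi f = 0 <-> stably_zero confl f],
      forall (x i c : E) (j : Hom x i) (p : Hom i c),
        confl _ _ _ j p -> injective_ob confl i -> isom (theta _ _ _ j p),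
      forall (x i c x' i' c' : E) (j : Hom x i) (p : Hom i c)
        (j' : Hom x' i') (p' : Hom i' c')
        (a : Hom x x') (b : Hom i i') (g : Hom c c'),
        confl _ _ _ j p -> injective_ob confl i ->
        confl _ _ _ j' p' -> injective_ob confl i' ->
        b \oc j = j' \oc a -> g \oc p = p' \oc b ->
        theta _ _ _ j' p' \oc fmor pi g =
          fmor (shift T) (fmor pi a) \oc theta _ _ _ j p &
      forall (x y z i c : E) (u : Hom x y) (v : Hom y z)
        (j : Hom x i) (p : Hom i c) (b : Hom y i) (g : Hom z c),
        confl _ _ _ u v -> confl _ _ _ j p -> injective_ob confl i ->
        b \oc u = j -> g \oc v = p \oc b ->
        dist (fmor pi u) (fmor pi v) (theta _ _ _ j p \oc fmor pi g)].

(** * The category generated by a (-1)-spherical object *)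

Definition spherical_m1 (K : fieldType) (T : triangulated K) (s : T) : Prop :=
  forall i : int,
    has_dim (Hom s (shiftz i s)) (if (i == 0) || (i == -1) then 1 else 0).

Definition is_T_m1 (K : fieldType) (T : triangulated K) : Prop :=
  [/\ idempotent_complete T, algebraic T &
      exists2 s : T, spherical_m1 s & classically_generates s].

(** * The arc model *)

Definition admissible (t u : int) : bool := (u < t) && odd `|t - u|.

Definition arc_hom (t u z v : int) : Prop :=
  let k := ((t - u + 1) %/ 2)%Z in
  exists2 i : int, 0 <= i <= k - 1 &
    (z = t - 2 * i /\ v <= u) \/ (v = u + 1 + 2 * i /\ t + 1 <= z).

(* arc t u is an indecomposable object corresponding to the admissible arc
   (t, u); its values at the other pairs of integers are irrelevant. *)
Record arc_model (K : fieldType) (T : triangulated K) (arc : int -> int -> T)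
  : Prop := ArcModel {
  arc_indec : forall t u, admissible t u -> indecomposable (arc t u);
  arc_inj : forall t u z v, admissible t u -> admissible z v ->
    isomorphic (arc t u) (arc z v) -> (t, u) = (z, v);
  arc_surj : forall x : T, indecomposable x ->
    exists t u, admissible t u /\ isomorphic (arc t u) x;
  arc_shift : forall t u, admissible t u ->
    isomorphic (shift T (arc t u)) (arc (t - 1) (u - 1));
  arc_arrow : forall t u z v, admissible t u -> admissible z v ->
    (exists f : Hom (arc t u) (arc z v), irreducible_mor f) <->
    (z, v) = (t, u - 2) \/ (z, v) = (t - 2, u);
  arc_hom1 : forall t u z v, admissible t u -> admissible z v ->
    arc_hom t u z v -> has_dim (Hom (arc t u) (arc z v)) 1;
  arc_hom0 : forall t u z v, admissible t u -> admissible z v ->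
    ~ arc_hom t u z v -> forall f : Hom (arc t u) (arc z v), f = 0 }.

(** * Hom-configurations *)

(* A collection of isomorphism classes of objects is encoded as the set of
   objects in these classes, i.e. a set closed under isomorphism. *)
Definition hom_configuration_m1 (K : fieldType) (T : triangulated K)
    (H : set T) : Prop :=
  [/\ forall x y : T, isomorphic x y -> H x -> H y,
      forall x : T, H x -> indecomposable x &
      forall h : T, indecomposable h ->
        (H h <->
         forall x : T, H x -> ~ isomorphic x h ->
         forall i : int, i \in [:: 0; -1] ->
         forall f : Hom x (shiftz i h), f = 0)].

(** * Noncrossing partitions of the integers *)

Definition int_partition (P : set (set int)) : Prop :=
  partition P id [set: int].

Definition noncrossing (P : set (set int)) : Prop :=
  forall B B' : set int, P B -> P B' -> B <> B' ->
  ~ exists a b c e : int, [/\ a < b, b < c & c < e] /\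
      [/\ B a, B c, B' b & B' e].

Definition at_most_one_infinite_block (P : set (set int)) : Prop :=
  forall B B' : set int, P B -> P B' ->
    infinite_set B -> infinite_set B' -> B = B'.

(** * The map f *)

Definition has_arc (K : fieldType) (T : triangulated K)
    (arc : int -> int -> T) (H : set T) (m u : int) : Prop :=
  admissible m u /\ H (arc m u).

Definition next_in (B : set int) (n p : int) : Prop :=
  [/\ B p, n < p & forall q, B q -> n < q -> p <= q].

Definition last_in (B : set int) (n : int) : Prop :=
  forall q, B q -> q <= n.

(* The point n' = 0.5 + 2n is represented by n.  Thus n' + 0.5 is 2n + 1, and
   m + 0.5 is the point p' for the p such that m = 2p. *)
Definition block_rule (K : fieldType) (T : triangulated K)
    (arc : int -> int -> T) (H : set T) (P : set (set int)) : Prop :=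
  forall (B : set int) (n : int), P B -> B n ->
    (forall m, has_arc arc H m (2 * n + 1) ->
       exists2 p, m = 2 * p & next_in B n p) /\
    ((forall m, ~ has_arc arc H m (2 * n + 1)) -> last_in B n).

(* f H is the partition satisfying the rule; see block_rule_uniq.  If no
   partition does, then f H is the empty set, which is not a partition. *)
Definition f_map (K : fieldType) (T : triangulated K)
    (arc : int -> int -> T) (H : set T) : set (set int) :=
  xget set0 [set P | int_partition P /\ block_rule arc H P].

Lemma block_rule_uniq (K : fieldType) (T : triangulated K)
    (arc : int -> int -> T) (H : set T) (P Q : set (set int)) :
  int_partition P -> int_partition Q ->
  block_rule arc H P -> block_rule arc H Q -> P = Q.
Proof.
have chain P1 P2 : block_rule arc H P1 -> block_rule arc H P2 ->
    forall (B C : set int) (k : nat) (n m : int), P1 B -> P2 C ->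
    n <= m -> m - n <= k%:Z -> B n -> B m -> C n -> C m.
  move=> r1 r2 B C; elim=> [|k IHk] n m PB PC nm mn Bn Bm Cn.
    by have -> : m = n by lia.
  have [->//|nm'] := eqVneq m n.
  have [s1 l1] := r1 B n PB Bn; have [s2 _] := r2 C n PC Cn.
  have [[a arca]|noarc] := pselect (exists a, has_arc arc H a (2 * n + 1)).
    have [p ap [Bp np pmin]] := s1 _ arca.
    have [p' ap' [Cp' _ _]] := s2 _ arca.
    have pp' : p' = p by lia.
    rewrite {}pp' in Cp'.
    have pm : p <= m by apply: pmin => //; lia.
    by apply: (IHk p m) => //; lia.
  have /l1/(_ _ Bm) : forall m, ~ has_arc arc H m (2 * n + 1).
    by move=> a arca; apply: noarc; exists a.
  by lia.
have sub P1 P2 : int_partition P1 -> int_partition P2 ->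
    block_rule arc H P1 -> block_rule arc H P2 ->
    forall (B C : set int) n, P1 B -> P2 C -> B n -> C n -> B `<=` C.
  move=> _ [cov2 triv2 _] r1 r2 B C n PB PC Bn Cn m Bm.
  have [nm|mn] := leP n m.
    by apply: (chain _ _ r1 r2 B C `|m - n|%N n m) => //; lia.
  have : cover P2 id m by rewrite cov2.
  move=> [C' PC' C'm].
  suff C'n : C' n by rewrite -(triv2 C' C) //; exists n.
  by apply: (chain _ _ r1 r2 B C' `|n - m|%N m n) => //; lia.
have half P1 P2 : int_partition P1 -> int_partition P2 ->
    block_rule arc H P1 -> block_rule arc H P2 -> P1 `<=` P2.
  move=> p1 p2 r1 r2 B PB; have [cov2 _ _] := p2.
  have [n Bn] : B !=set0 by case: p1 => _ _; apply.
  have : cover P2 id n by rewrite cov2.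
  move=> [C PC Cn].
  suff -> : B = C by [].
  by apply/seteqP; split; [apply: (sub P1 P2)|apply: (sub P2 P1)]; eauto.
by move=> pP pQ rP rQ; apply/seteqP; split; apply: half.
Qed.

(* Main.v *)
From mathcomp Require Import all_boot all_order all_algebra.
From mathcomp Require Import boolp classical_sets functions cardinality zify.
Require Import Defs.

Set Implicit Arguments.
Unset Strict Implicit.
Unset Printing Implicit Defensive.

Import Order.TTheory GRing.Theory Num.Theory.
Local Open Scope classical_set_scope.
Local Open Scope ring_scope.

(** The description of the Hom-spaces shows that Hom(x, h) and Hom(x, Sigma^-1 h)
both vanish exactly when the arcs of x and h neither cross nor share an endpoint
([arc_hom_apart], [hom_zero_apart]).  Hence a Hom-configuration is the same thing
as a maximal set A of pairwise disjoint, pairwise noncrossing admissible arcs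
([arc_config]), and everything else is combinatorics of such sets.

The key fact about a maximal A is that at most one integer is isolated, that is,
incident with no arc of A ([isolated_unique]).  Call an interval closed if no arc
of A has exactly one endpoint in its interior.  By induction on the length, the
two ends of a closed interval differ by an odd number unless its interior has
exactly one isolated point, in which case they differ by an even number: two
consecutive isolated points would be joined by an admissible arc that could be
added to A ([arc_closed_parity]).  As admissible arcs have odd length, no arc
passes over an isolated point, and then two isolated points would bound a closed
interval, giving again an arc that could be added.

Write an arc with even upper end as (2p, 2n+1) and one with odd upper end as
(2n+1, 2q).  The arcs of the first kind are the steps n -> p of the blocks of the
partition P defined by A; noncrossing of arcs makes P exist and be noncrossing.
If B is a block with least element q, then 2q is either the lower end of an arc
(2n+1, 2q), in which case n is the greatest element of B, or it is isolated;
similarly for a greatest element.  So the arcs of the second kind are the pairs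
(greatest, least) of the bounded blocks ([arc_ends]), whence A is determined by P.
Moreover an infinite block with a least or greatest element produces an isolated
point, so there is at most one such block, and a block unbounded on both sides
crosses every other infinite block.

Conversely, a noncrossing P with at most one infinite block defines a set of arcs
by these recipes ([arcs_of]).  It is maximal because the two ends of an arc that
could be added would be isolated points of opposite parity, which come from an
infinite block with a least element and one with a greatest element; these would
be the same block, which would be bounded. *)

(** * Arcs and Hom-spaces *)

(** The arcs (a, b) and (t, u) have four distinct endpoints and do not cross:
they lie side by side or are strictly nested. *)
Definition apart (a b t u : int) : Prop :=
  t < b \/ a < u \/ (b < u /\ t < a) \/ (u < b /\ a < t).

(** The second Hom-space is Hom(x, Sigma^-1 h), as Sigma^-1 (t, u) = (t+1, u+1). *)
Lemma arc_hom_apart a b t u : admissible a b -> admissible t u ->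
  (~ arc_hom a b t u /\ ~ arc_hom a b (t + 1) (u + 1)) <-> apart a b t u.
Proof.
move=> ab tu; split; last first.
  by move=> cp; split=> -[i]; rewrite /apart /admissible in cp ab tu *; lia.
rewrite /apart => -[n0 n1].
apply: contrapT => ncp.
(* The witness i counts the steps of length two from a down to t, or to t + 1, or
   from b + 1 up to u, or to u + 1; parity and position decide which applies. *)
have : a = t %[mod 2]%Z \/ a = t + 1 %[mod 2]%Z by lia.
case=> par.
  have [/andP[ta ub]|tu'] := boolP ((t <= a) && (u <= b)).
    by apply: n0; exists ((a - t) %/ 2)%Z; rewrite /admissible in ab tu; lia.
  by apply: n1; exists ((u - b) %/ 2)%Z; rewrite /admissible in ab tu; lia.
have [bu|ub] := leP b u.
  by apply: n0; exists ((u - b - 1) %/ 2)%Z; rewrite /admissible in ab tu; lia.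
by apply: n1; exists ((a - t - 1) %/ 2)%Z; rewrite /admissible in ab tu; lia.
Qed.

(** * Sets of integers *)

Lemma least_ge (S : set int) (z c : int) : S c -> z <= c ->
  exists x, [/\ S x, z <= x, x <= c & forall q, S q -> z <= q -> x <= q].
Proof.
have [k] := ubnP `|c - z|%N; elim: k c => // k IHk c ck Sc zc.
have [[q [Sq zq qc]]|noq] := pselect (exists q, [/\ S q, z <= q & q < c]).
  by have [|x [Sx zx xq xmin]] := IHk q _ Sq zq; [lia|exists x; split=> //; lia].
exists c; split=> // q Sq zq; rewrite leNgt; apply/negP => qc.
by apply: noq; exists q.
Qed.

Lemma greatest_le (S : set int) (z a : int) : S a -> a <= z ->
  exists x, [/\ S x, x <= z, a <= x & forall q, S q -> q <= z -> q <= x].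
Proof.
move=> Sa az; have [| |x [Sx zx xa xmin]] :=
  @least_ge [set q | S (- q)] (- z) (- a); rewrite /= ?opprK //; first by lia.
exists (- x); split=> //; try lia; move=> q Sq qz.
by have := xmin (- q); rewrite /= opprK => /(_ Sq); lia.
Qed.

(** A set of integers with elements on both sides of a cut has two consecutive
elements on both sides of it. *)
Lemma straddle (B : set int) (a c z : int) : B a -> B c -> a <= z -> z < c ->
  exists x x', [/\ B x, next_in B x x', a <= x, x <= z & z < x' <= c].
Proof.
move=> Ba Bc az zc.
have [x [Bx xz ax xmax]] := greatest_le Ba az.
have [|x' [Bx' zx' x'c xmin]] := @least_ge B (z + 1) c Bc; first by lia.
exists x, x'; split=> //; last by lia.
split=> // [|q Bq xq]; first by lia.
have [/(xmax _ Bq)|zq] := leP q z; first by lia.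
by apply: xmin => //; lia.
Qed.

Lemma bounded_finite (B : set int) (q n : int) :
  (forall x, B x -> q <= x) -> (forall x, B x -> x <= n) -> finite_set B.
Proof.
move=> qB Bn; apply:
  (@sub_finite_set _ _ ((fun k : nat => q + k%:Z) @` `I_(`|n - q|%N.+1))).
  move=> x Bx; exists `|x - q|%N => /=; have := qB x Bx; have := Bn x Bx; lia.
exact/finite_image/finite_II.
Qed.

Lemma finite_bounded (B : set int) : finite_set B ->
  exists M : int, forall x, B x -> - M <= x <= M.
Proof.
move=> /finite_seqP[s ->]; elim: s => [|y s [M IHs]]; first by exists 0.
exists (`|y| + `|M|) => x /=; rewrite inE => /orP[/eqP ->|/IHs]; lia.
Qed.

(** The counterpart of [last_in]; as there, n is not required to lie in B. *)
Definition first_in (B : set int) (n : int) : Prop := forall q, B q -> n <= q.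

Lemma next_in_uniq B n p p' : next_in B n p -> next_in B n p' -> p = p'.
Proof.
by move=> [Bp np pm] [Bp' np' pm']; have := pm _ Bp' np'; have := pm' _ Bp np; lia.
Qed.

Lemma next_in_or_last (B : set int) n : (exists p, next_in B n p) \/ last_in B n.
Proof.
have [[q [Bq nq]]|h] := pselect (exists q, B q /\ n < q).
  have [|p [Bp np _ pm]] := @least_ge B (n + 1) q Bq; first by lia.
  by left; exists p; split=> // [|r Br nr]; [lia|apply: pm => //; lia].
by right=> q Bq; rewrite leNgt; apply/negP => nq; apply: h; exists q.
Qed.

Lemma prev_in_or_first (B : set int) p : B p ->
  (exists2 n, B n & next_in B n p) \/ first_in B p.
Proof.
move=> Bp; have [[q [Bq qp]]|h] := pselect (exists q, B q /\ q < p).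
  have [|n [Bn np _ nm]] := @greatest_le B (p - 1) q Bq; first by lia.
  left; exists n => //; split=> // [|r Br nr]; first by lia.
  by rewrite leNgt; apply/negP => rp; have := nm r Br; lia.
by right=> q Bq; rewrite leNgt; apply/negP => qp; apply: h; exists q.
Qed.

Lemma not_first (B : set int) q : ~ (exists2 q, B q & first_in B q) -> B q ->
  forall z, exists2 x, B x & x < z.
Proof.
move=> nf Bq z; apply: contrapT => h.
have zB x : B x -> z <= x.
  by move=> Bx; rewrite leNgt; apply/negP => xz; apply: h; exists x.
have [x [Bx _ _ xmin]] := least_ge Bq (zB _ Bq).
by apply: nf; exists x => // y By; apply: xmin => //; exact: zB.
Qed.

Lemma not_last (B : set int) q : ~ (exists2 q, B q & last_in B q) -> B q ->
  forall z, exists2 x, B x & z < x.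
Proof.
move=> nf Bq z; apply: contrapT => h.
have zB x : B x -> x <= z.
  by move=> Bx; rewrite leNgt; apply/negP => xz; apply: h; exists x.
have [x [Bx _ _ xmax]] := greatest_le Bq (zB _ Bq).
by apply: nf; exists x => // y By; apply: xmax => //; exact: zB.
Qed.

(** * Maximal sets of arcs *)

(** A set A of arcs, given by its membership predicate, that consists of
admissible arcs which are pairwise [apart] and is maximal for this property. *)
Definition arc_config (A : int -> int -> Prop) : Prop :=
  (forall t u, A t u -> admissible t u) /\
  forall t u, admissible t u ->
    (A t u <-> forall a b, A a b -> (a, b) <> (t, u) -> apart a b t u).

(** The integer x is incident with no arc of A. *)
Definition isolated (A : int -> int -> Prop) (x : int) : Prop :=
  forall y, ~ A x y /\ ~ A y x.

(** No arc of A has exactly one endpoint strictly between x and y. *)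
Definition arc_closed (A : int -> int -> Prop) (x y : int) : Prop :=
  forall a b, A a b -> (x < a < y) = (x < b < y).

Section Config.
Variable A : int -> int -> Prop.
Hypothesis cA : arc_config A.

Lemma config_apart a b t u :
  A a b -> A t u -> (a = t /\ b = u) \/ apart a b t u.
Proof.
move=> Aab Atu; have [[-> ->]|ne] := pselect ((a, b) = (t, u)); first by left.
by right; apply: (proj1 (cA.2 t u (cA.1 _ _ Atu))).
Qed.

Lemma config_lt t u : A t u -> u < t.
Proof. by move=> /cA.1/andP[]. Qed.

Lemma arc_closed_arc t u : A t u -> arc_closed A u t.
Proof.
move=> Atu a b Aab; have := config_lt Aab; have := config_apart Aab Atu.
by rewrite /apart; lia.
Qed.

(** By maximality, as (y, x) could be added to A. *)
Lemma isolated_pair x y : isolated A x -> isolated A y -> admissible y x ->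
  arc_closed A x y -> False.
Proof.
move=> ix iy yx cl.
have [_] := ix y; apply; apply/(cA.2 y x yx) => a b Aab _.
have ax : a <> x by move=> e; apply: (ix b).1; rewrite -e.
have ay : a <> y by move=> e; apply: (iy b).1; rewrite -e.
have bx : b <> x by move=> e; apply: (ix a).2; rewrite -e.
have by' : b <> y by move=> e; apply: (iy a).2; rewrite -e.
have := cl _ _ Aab; have := config_lt Aab; move: yx.
by rewrite /apart /admissible; lia.
Qed.

(** A closed interval has odd length and no isolated point inside, or even length
and exactly one isolated point inside. *)
Lemma arc_closed_parity x y : x < y -> arc_closed A x y ->
  (admissible y x /\ forall z, x < z < y -> ~ isolated A z) \/
  exists z, [/\ isolated A z, arc_closed A x z, admissible z x, admissible y z &
    forall z', x < z' < y -> isolated A z' -> z' = z].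
Proof.
have [k] := ubnP `|y - x|%N; elim: k x y => // k IHk x y yxk xy cl.
have [y1|y1] := eqVneq y (x + 1).
  by left; rewrite /admissible; split=> [|z]; lia.
(* Look at x + 1: either it is isolated, or it is the lower end of an arc (t, x+1)
   inside the interval, which is cut at t. *)
have [ix|/existsNP[t xt]] := pselect (isolated A (x + 1)).
  have cl1 : arc_closed A (x + 1) y.
    move=> a b Aab; have := cl _ _ Aab.
    have : a <> x + 1 by move=> e; apply: (ix b).1; rewrite -e.
    have : b <> x + 1 by move=> e; apply: (ix a).2; rewrite -e.
    by lia.
  have [||[adm noi]|[z [iz clz adm1 _ _]]] := IHk (x + 1) y _ _ cl1; try by lia.
    right; exists (x + 1); split=> //; rewrite /admissible in adm *; try lia.
      by move=> a b _; lia.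
    move=> z' xz' iz'; have [//|ne] := eqVneq z' (x + 1).
    by case: (noi z') => //; lia.
  by case: (isolated_pair ix iz adm1 clz).
have {}xt : A (x + 1) t \/ A t (x + 1) by apply: contrapT => h; apply: xt; tauto.
have {}xt : A t (x + 1).
  by case: xt => // xt; have := cl _ _ xt; have := config_lt xt; lia.
have tx := config_lt xt.
have ty : t < y by have := cl _ _ xt; lia.
have clt := arc_closed_arc xt.
have clty : arc_closed A t y.
  move=> a b Aab; have := cl _ _ Aab; have := config_apart Aab xt.
  by have := config_lt Aab; rewrite /apart; lia.
have tadm := cA.1 _ _ xt.
have noit : forall z, x < z < t + 1 -> ~ isolated A z.
  have [||[_ noi]|[z [_ _ z1 z2 _]]] := IHk (x + 1) t _ _ clt; try by lia.
    move=> z xzt iz; have [e|ne] := eqVneq z (x + 1).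
      by apply: (iz t).2; rewrite e.
    have [e|ne'] := eqVneq z t; first by apply: (iz (x + 1)).1; rewrite e.
    by apply: (noi z) => //; lia.
  by rewrite /admissible in tadm z1 z2; lia.
have [||[adm noi]|[z [iz clz z1 z2 zu]]] := IHk t y _ _ clty; try by lia.
  left; split; first by rewrite /admissible in tadm adm *; lia.
  move=> z xzy iz; have [zt|tz] := ltP z (t + 1).
    by case: (noit z) => //; lia.
  by case: (noi z) => //; lia.
right; exists z; split=> //; try by rewrite /admissible in z1 z2 tadm *; lia.
  move=> a b Aab; have := cl _ _ Aab; have := clz _ _ Aab.
  have := config_apart Aab xt; have := config_lt Aab.
  have : a <> z by move=> e; apply: (iz b).1; rewrite -e.
  have : b <> z by move=> e; apply: (iz a).2; rewrite -e.
  by move: z1 z2; rewrite /apart /admissible; lia.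
move=> z' xz' iz'; have [zt|tz] := ltP z' (t + 1).
  by case: (noit z') => //; lia.
by apply: zu => //; lia.
Qed.

Lemma arc_not_over_isolated t u z : A t u -> u < z < t -> ~ isolated A z.
Proof.
move=> Atu uzt; have := arc_closed_parity (config_lt Atu) (arc_closed_arc Atu).
case=> [[_ noi]|[z' [_ _ z1 z2 _]]]; first exact: noi.
by have := cA.1 _ _ Atu; rewrite /admissible in z1 z2 *; lia.
Qed.

Lemma isolated_unique x y : isolated A x -> isolated A y -> x = y.
Proof.
wlog xy : x y / x <= y => [h ix iy|ix iy].
  by have [/h|/ltW/h/(_ iy ix)] := leP x y; [exact|].
have [//|ne] := eqVneq x y; exfalso.
have cl : arc_closed A x y.
  move=> a b Aab; have ba := config_lt Aab.
  have : a <> x by move=> e; apply: (ix b).1; rewrite -e.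
  have : a <> y by move=> e; apply: (iy b).1; rewrite -e.
  have : b <> x by move=> e; apply: (ix a).2; rewrite -e.
  have : b <> y by move=> e; apply: (iy a).2; rewrite -e.
  have : ~ (b < x < a) by move=> /(arc_not_over_isolated Aab); apply.
  have : ~ (b < y < a) by move=> /(arc_not_over_isolated Aab); apply.
  by lia.
have [|[adm _]|[z [iz clz adm _ _]]] := arc_closed_parity _ cl; first by lia.
  exact: isolated_pair ix iy adm cl.
exact: isolated_pair ix iz adm clz.
Qed.

End Config.

(** * The partition defined by a maximal set of arcs *)

(** The rule [block_rule] for an arbitrary set of arcs. *)
Definition arc_rule (A : int -> int -> Prop) (P : set (set int)) : Prop :=
  forall (B : set int) (n : int), P B -> B n ->
    (forall m, A m (2 * n + 1) -> exists2 p, m = 2 * p & next_in B n p) /\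
    ((forall m, ~ A m (2 * n + 1)) -> last_in B n).

Lemma block_of (P : set (set int)) x : int_partition P -> exists2 B, P B & B x.
Proof. by case=> cov _ _; have : cover P id x by rewrite cov. Qed.

Lemma block_eq (P : set (set int)) B B' x : int_partition P ->
  P B -> P B' -> B x -> B' x -> B = B'.
Proof. by case=> _ triv _ PB PB' Bx B'x; apply: triv => //; exists x. Qed.

Lemma admissible_ends t u : admissible t u ->
  (exists p n, t = 2 * p /\ u = 2 * n + 1) \/
  (exists n q, t = 2 * n + 1 /\ u = 2 * q).
Proof.
rewrite /admissible => tu.
have [t0|t1] : (t = 0 %[mod 2])%Z \/ (t = 1 %[mod 2])%Z by lia.
  by left; exists (t %/ 2)%Z, (u %/ 2)%Z; lia.
by right; exists (t %/ 2)%Z, (u %/ 2)%Z; lia.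
Qed.

(** A block B with neither a least nor a greatest element crosses any other
infinite block, as such a block has elements inside and outside some interval
with ends in B. *)
Lemma two_sided_infinite (P : set (set int)) (B B' : set int) : int_partition P ->
  noncrossing P -> P B -> P B' -> infinite_set B' ->
  ~ ((exists2 q, B q & first_in B q) \/ (exists2 n, B n & last_in B n)) -> B = B'.
Proof.
move=> [_ _ ne] nc PB PB' infB' /not_orP[nf nl]; apply: contrapT => neB.
have [b Bb] := ne _ PB; have [b' B'b'] := ne _ PB'.
have [a Ba ab'] := not_first nf Bb b'; have [c Bc b'c] := not_last nl Bb b'.
apply: infB'; apply: (bounded_finite (q := a) (n := c)) => e B'e;
  rewrite leNgt; apply/negP => ae.
  by apply: (nc B' B) => //; [exact/nesym|exists e, a, b', c].
by apply: (nc B B') => //; exists a, b', c, e.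
Qed.

Section ConfigPartition.
Variable A : int -> int -> Prop.
Hypothesis cA : arc_config A.

(** The equivalence relation generated by n ~ p for (2p, 2n+1) in A: every set
saturated for these pairs contains both n and m or neither. *)
Definition chained (n m : int) : Prop :=
  forall C : set int,
    (forall x y, A (2 * y) (2 * x + 1) -> C x <-> C y) -> C n <-> C m.

(** The open interval between n and p is saturated. *)
Lemma chained_next n p q : A (2 * p) (2 * n + 1) -> chained n q -> n < q -> p <= q.
Proof.
move=> Ap nq lt_nq; rewrite leNgt; apply/negP => qp.
suff [+ _] : ~ (n < n < p) <-> ~ (n < q < p) by apply; lia.
apply: (nq (fun x => ~ (n < x < p))) => x y Axy.
have := config_apart cA Axy Ap; have := config_lt cA Axy.
by rewrite /apart; lia.
Qed.

(** If no step starts at n, a saturated set containing n is cut out to the right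
by n and to the left by the steps that pass over n. *)
Lemma chained_last n q : (forall m, ~ A m (2 * n + 1)) -> chained n q -> q <= n.
Proof.
move=> nl nq.
pose C x := x <= n /\ forall a b, A (2 * b) (2 * a + 1) -> a < n < b -> a < x.
suff [Cnq _] : C n <-> C q by have [] : C q by apply: Cnq; split=> // a b _; lia.
apply: nq => x y Axy; have xy := config_lt cA Axy.
have xn : x <> n by move=> e; apply: (nl (2 * y)); rewrite -e.
split=> -[le_n h].
  have yn : y <= n.
    by rewrite leNgt; apply/negP => yn; have := h _ _ Axy; lia.
  by split=> // a b Aab anb; have := h _ _ Aab anb; lia.
split=> [|a b Aab anb]; first by lia.
have := h _ _ Aab anb; have := config_apart cA Aab Axy.
by rewrite /apart; lia.
Qed.

Lemma arc_rule_exists : exists P, int_partition P /\ arc_rule A P.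
Proof.
have chainedxx n : chained n n by [].
have chainedS n m : chained n m -> chained m n.
  by move=> nm C hC; have := nm C hC; tauto.
have chainedT n m p : chained n m -> chained m p -> chained n p.
  by move=> nm mp C hC; have := nm C hC; have := mp C hC; tauto.
exists (range (fun n => [set m | chained n m])); split.
  split.
  - by apply/seteqP; split=> // x _; exists [set m | chained x m] => //; exists x.
  - move=> _ _ [n _ <-] [m _ <-] [x [/= nx mx]]; apply/seteqP.
    by split=> y /= h; [apply: chainedT (chainedT _ _ _ mx (chainedS _ _ nx)) h|
                        apply: chainedT (chainedT _ _ _ nx (chainedS _ _ mx)) h].
  - by move=> _ [n _ <-]; exists n => /=.
move=> _ n [k _ <-] /= kn; split=> [m Am|nl q /= kq].
  have [[p [n' [mp nn']]]|[? [? []]]] := admissible_ends (cA.1 _ _ Am); last by lia.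
  have {nn'}nn' : n' = n by lia.
  subst n' m; exists p => //; split=> /=.
  - by move=> C hC; have := kn C hC; have := hC _ _ Am; tauto.
  - by have := config_lt cA Am; lia.
  - move=> q kq; apply: chained_next Am _.
    exact: chainedT (chainedS _ _ kn) kq.
apply: chained_last nl _; exact: chainedT (chainedS _ _ kn) kq.
Qed.

Variable P : set (set int).
Hypotheses (pP : int_partition P) (rP : arc_rule A P).

(** The steps between consecutive elements of a block are the arcs (2p, 2n+1). *)
Lemma arc_next B n p : P B -> B n -> (A (2 * p) (2 * n + 1) <-> next_in B n p).
Proof.
move=> PB Bn; have [r1 r2] := rP PB Bn; split=> [/r1[p' pp']|np].
  by have -> : p' = p by lia.
have [[m Am]|noA] := pselect (exists m, A m (2 * n + 1)).
  by have [p' mp' /(next_in_uniq np) pp'] := r1 _ Am; rewrite pp' -mp'.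
have [Bp lt_np _] := np.
by have := r2 (fun m Am => noA (ex_intro _ m Am)) p Bp; lia.
Qed.

Lemma config_noncrossing : noncrossing P.
Proof.
move=> B B' PB PB' ne [a [b [c [e [[ab bc ce] [Ba Bc B'b B'e]]]]]].
have disj z : B z -> B' z -> False.
  by move=> Bz B'z; apply: ne; exact: block_eq pP PB PB' Bz B'z.
have [|x [x' [Bx nx ax xb bx']]] := straddle Ba Bc (_ : a <= b) bc; first by lia.
have [Bx' _ _] := nx.
have [||y [y' [B'y ny b_y yx' x'y']]] := straddle B'b B'e (_ : b <= x') _; try by lia.
have := config_apart cA (proj2 (arc_next x' PB Bx) nx)
  (proj2 (arc_next y' PB' B'y) ny).
have xneb : x <> b by move=> e1; apply: (disj x) => //; rewrite e1.
have yne : y <> x' by move=> e1; apply: (disj y) => //; rewrite e1.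
by rewrite /apart; lia.
Qed.

(** No step of B passes over q, so B is bounded below by q; its least element r
must be q, since otherwise 2r is isolated and lies under the arc (2n+1, 2q). *)
Lemma arc_ends_first B n q : P B -> B n -> A (2 * n + 1) (2 * q) ->
  B q /\ first_in B q.
Proof.
move=> PB Bn Anq; have qn := config_lt cA Anq.
have fq : first_in B q.
  move=> y By; rewrite leNgt; apply/negP => yq.
  have [||x [x' [Bx nx yx xq' qx']]] := straddle By Bn (_ : y <= q - 1) _; try by lia.
  have := config_apart cA (proj2 (arc_next x' PB Bx) nx) Anq.
  by rewrite /apart; lia.
split=> //.
have [|r [Br qr rn rmin]] := least_ge Bn (_ : q <= n); first by lia.
suff -> : q = r by [].
apply: contrapT => qner.
case: (arc_not_over_isolated cA Anq (z := 2 * r)); first by lia.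
move=> y; split=> Ay.
  have [[p [x [rp yx]]]|[? [? []]]] := admissible_ends (cA.1 _ _ Ay); last by lia.
  have {rp}rp : p = r by lia.
  subst p y.
  have [B' PB' B'x] := block_of x pP.
  have [B'r xr _] := proj1 (arc_next r PB' B'x) Ay.
  have BB' := block_eq pP PB PB' Br B'r; rewrite -BB' in B'x.
  by have := rmin _ B'x; have := fq _ B'x; lia.
have [[? [? []]]|[m [r' [ym rr']]]] := admissible_ends (cA.1 _ _ Ay); first by lia.
have {rr'}rr' : r' = r by lia.
subst r' y; have rm := config_lt cA Ay.
have [nm|mn] := leP n m.
  by have := config_apart cA Anq Ay; rewrite /apart; lia.
have [|x [x' [Bx nx yx xq' qx']]] := straddle Br Bn (_ : r <= m) mn; first by lia.
have := config_apart cA (proj2 (arc_next x' PB Bx) nx) Ay.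
by rewrite /apart; lia.
Qed.

Lemma last_isolated B n : P B -> B n -> last_in B n ->
  (exists q, A (2 * n + 1) (2 * q)) \/ isolated A (2 * n + 1).
Proof.
move=> PB Bn ln.
have [h|noA] := pselect (exists q, A (2 * n + 1) (2 * q)); first by left.
right=> y; split=> Ay.
  have [[? [? []]]|[m [q [nm yq]]]] := admissible_ends (cA.1 _ _ Ay); first by lia.
  by apply: noA; exists q; rewrite -yq.
have [p _ [Bp np _]] := (rP PB Bn).1 _ Ay.
by have := ln _ Bp; lia.
Qed.

Lemma first_isolated B q : P B -> B q -> first_in B q ->
  (exists n, A (2 * n + 1) (2 * q)) \/ isolated A (2 * q).
Proof.
move=> PB Bq fq.
have [h|noA] := pselect (exists n, A (2 * n + 1) (2 * q)); first by left.
right=> y; split=> Ay.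
  have [[p [x [qp yx]]]|[? [? []]]] := admissible_ends (cA.1 _ _ Ay); last by lia.
  have {qp}qp : p = q by lia.
  subst p y; have [B' PB' B'x] := block_of x pP.
  have [B'q xq _] := proj1 (arc_next q PB' B'x) Ay.
  have BB' := block_eq pP PB PB' Bq B'q; rewrite -BB' in B'x.
  by have := fq _ B'x; lia.
have [[? [? []]]|[n [q' [yn _]]]] := admissible_ends (cA.1 _ _ Ay); first by lia.
by apply: noA; exists n; rewrite -yn.
Qed.

Lemma arc_ends_last B n q : P B -> B n -> A (2 * n + 1) (2 * q) -> last_in B n.
Proof.
move=> PB Bn Anq; apply: (rP PB Bn).2 => m Am.
have := config_apart cA Anq Am; have := config_lt cA Am.
by have := config_lt cA Anq; rewrite /apart; lia.
Qed.

(** The arcs (2n+1, 2q) join the two ends of the bounded blocks. *)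
Lemma arc_ends B n q : P B -> B n ->
  (A (2 * n + 1) (2 * q) <-> [/\ B q, first_in B q & last_in B n]).
Proof.
move=> PB Bn; split=> [Anq|[Bq fq ln]].
  by have [? ?] := arc_ends_first PB Bn Anq; split=> //; exact: arc_ends_last Anq.
(* If both 2q and 2n+1 were isolated, they would coincide. *)
have [[q' Aq']|isn] := last_isolated PB Bn ln.
  have [Bq' fq'] := arc_ends_first PB Bn Aq'.
  suff -> : q = q' by [].
  by have := fq _ Bq'; have := fq' _ Bq; lia.
have [[n' An']|isq] := first_isolated PB Bq fq.
  have [B' PB' B'n'] := block_of n' pP.
  have [B'q _] := arc_ends_first PB' B'n' An'.
  have BB' := block_eq pP PB PB' Bq B'q; rewrite -BB' in PB' B'n'.
  have ln' := arc_ends_last PB' B'n' An'.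
  suff -> : n = n' by [].
  by have := ln _ B'n'; have := ln' _ Bn; lia.
by have := isolated_unique cA isn isq; lia.
Qed.

Lemma infinite_first_isolated B q : P B -> infinite_set B -> B q -> first_in B q ->
  isolated A (2 * q).
Proof.
move=> PB infB Bq fq; have [[n An]|//] := first_isolated PB Bq fq.
have [B' PB' B'n] := block_of n pP.
have [B'q _] := arc_ends_first PB' B'n An.
have BB' := block_eq pP PB PB' Bq B'q; rewrite -BB' in PB' B'n.
by case: infB; exact: (bounded_finite fq (arc_ends_last PB' B'n An)).
Qed.

Lemma infinite_last_isolated B n : P B -> infinite_set B -> B n -> last_in B n ->
  isolated A (2 * n + 1).
Proof.
move=> PB infB Bn ln; have [[q An]|//] := last_isolated PB Bn ln.
have [Bq fq] := arc_ends_first PB Bn An.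
by case: infB; exact: bounded_finite fq ln.
Qed.

Lemma config_one_infinite : at_most_one_infinite_block P.
Proof.
move=> B B' PB PB' infB infB'.
have nc := config_noncrossing.
pose ends C := (exists2 q, C q & first_in C q) \/ (exists2 n, C n & last_in C n).
have [eB|nB] := pselect (ends B); last exact: two_sided_infinite nc PB PB' infB' nB.
have [eB'|nB'] := pselect (ends B'); last first.
  by apply/esym; exact: two_sided_infinite nc PB' PB infB nB'.
case: eB eB' => -[q Bq hq] [] [q' Bq' hq'].
- have e := isolated_unique cA (infinite_first_isolated PB infB Bq hq)
    (infinite_first_isolated PB' infB' Bq' hq').
  by have qq' : q = q' by [lia]; apply: block_eq pP PB PB' Bq _; rewrite ?qq'.
- have := isolated_unique cA (infinite_first_isolated PB infB Bq hq)
    (infinite_last_isolated PB' infB' Bq' hq').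
  by lia.
- have := isolated_unique cA (infinite_last_isolated PB infB Bq hq)
    (infinite_first_isolated PB' infB' Bq' hq').
  by lia.
- have e := isolated_unique cA (infinite_last_isolated PB infB Bq hq)
    (infinite_last_isolated PB' infB' Bq' hq').
  by have qq' : q = q' by [lia]; apply: block_eq pP PB PB' Bq _; rewrite ?qq'.
Qed.

End ConfigPartition.

(** A maximal set of arcs is determined by its partition. *)
Lemma arc_config_inj A A' P : arc_config A -> arc_config A' -> int_partition P ->
  arc_rule A P -> arc_rule A' P -> forall t u, A t u <-> A' t u.
Proof.
move=> cA cA' pP rA rA'.
have sub A1 A2 : arc_config A1 -> arc_config A2 -> arc_rule A1 P -> arc_rule A2 P ->
    forall t u, A1 t u -> A2 t u.
  move=> c1 c2 r1 r2 t u A1tu.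
  have [] := admissible_ends (c1.1 _ _ A1tu) => -[x [y [et eu]]]; subst t u.
    have [B PB By] := block_of y pP.
    exact/(arc_next r2 x PB By)/(arc_next r1 x PB By).
  have [B PB Bx] := block_of x pP.
  exact/(arc_ends c2 pP r2 y PB Bx)/(arc_ends c1 pP r1 y PB Bx).
by move=> t u; split; apply: sub.
Qed.

(** * The maximal set of arcs of a partition *)

(** The arcs (2p, 2n+1) for p next after n in a block, and the arcs (2n+1, 2q) for
a block with least element q and greatest element n (q = n is possible). *)
Definition arcs_of (P : set (set int)) (t u : int) : Prop :=
  (exists B n p, [/\ P B, B n, next_in B n p & t = 2 * p /\ u = 2 * n + 1]) \/
  (exists B n q, [/\ P B, B q /\ B n, first_in B q, last_in B n &
     t = 2 * n + 1 /\ u = 2 * q]).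

Section ArcsOf.
Variable P : set (set int).
Hypotheses (pP : int_partition P) (ncP : noncrossing P)
  (infP : at_most_one_infinite_block P).

Lemma blocks_neq B B' x y : P B -> P B' -> B <> B' -> B x -> B' y -> x <> y.
Proof.
by move=> PB PB' ne Bx B'y e; apply: ne; apply: block_eq pP PB PB' Bx _; rewrite e.
Qed.

Lemma blocks_not_cross B B' a b c e : P B -> P B' -> B <> B' ->
  B a -> B c -> B' b -> B' e -> ~ [&& a < b, b < c & c < e].
Proof.
move=> PB PB' ne Ba Bc B'b B'e /and3P[ab bc ce]; apply: (ncP PB PB' ne).
by exists a, b, c, e.
Qed.

Lemma arcs_of_apart a b t u : arcs_of P a b -> arcs_of P t u ->
  (a, b) <> (t, u) -> apart a b t u.
Proof.
(* an arc of the first kind against one of the second kind *)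
have key12 B n p B' m q : P B -> B n -> next_in B n p -> P B' -> B' q -> B' m ->
    first_in B' q -> last_in B' m -> apart (2 * p) (2 * n + 1) (2 * m + 1) (2 * q).
  move=> PB Bn [Bp np pm] PB' B'q B'm fq lm.
  have [BB'|ne] := pselect (B = B').
    have := fq n; have := lm p; rewrite -BB' => /(_ Bp) pm' /(_ Bn) qn.
    by rewrite /apart; lia.
  have pm' := blocks_neq PB PB' ne Bp B'm.
  have nq := blocks_neq PB PB' ne Bn B'q.
  have := @blocks_not_cross B B' n q p m PB PB' ne Bn Bp B'q B'm.
  have := @blocks_not_cross B' B q n m p PB' PB (nesym ne) B'q B'm Bn Bp.
  have pq := blocks_neq PB PB' ne Bp B'q.
  have nm := blocks_neq PB PB' ne Bn B'm.
  have : q <= m by exact: fq.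
  by rewrite /apart; lia.
case=> [[B [n [p [PB Bn np [-> ->]]]]]|[B [n [p [PB [Bp Bn] fp ln [-> ->]]]]]];
case=> [[B' [n' [p' [PB' Bn' np' [-> ->]]]]]|
        [B' [n' [p' [PB' [Bp' Bn'] fp' ln' [-> ->]]]]]] neq.
- have nn' : n <> n'.
    move=> e; subst n'; apply: neq.
    have BB' := block_eq pP PB PB' Bn Bn'; subst B'.
    by rewrite (next_in_uniq np np').
  have [Bp lnp pm] := np; have [Bp' lnp' pm'] := np'.
  have [BB'|ne] := pselect (B = B').
    subst B'; have := pm _ Bp'; have := pm _ Bn'; have := pm' _ Bp; have := pm' _ Bn.
    by rewrite /apart; lia.
  have pp' := blocks_neq PB PB' ne Bp Bp'.
  have pn' := blocks_neq PB PB' ne Bp Bn'.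
  have np'' := blocks_neq PB PB' ne Bn Bp'.
  have := @blocks_not_cross B B' n n' p p' PB PB' ne Bn Bp Bn' Bp'.
  have := @blocks_not_cross B' B n' n p' p PB' PB (nesym ne) Bn' Bp' Bn Bp.
  by rewrite /apart; lia.
- exact: key12 PB Bn np PB' Bp' Bn' fp' ln'.
- by have := key12 _ _ _ _ _ _ PB' Bn' np' PB Bp Bn fp ln; rewrite /apart; lia.
- have ne : B <> B'.
    move=> e; subst B'; apply: neq; congr (2 * _ + 1, 2 * _).
      by have := ln _ Bn'; have := ln' _ Bn; lia.
    by have := fp _ Bp'; have := fp' _ Bp; lia.
  have pp' := blocks_neq PB PB' ne Bp Bp'.
  have nn' := blocks_neq PB PB' ne Bn Bn'.
  have pn' := blocks_neq PB PB' ne Bp Bn'.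
  have np'' := blocks_neq PB PB' ne Bn Bp'.
  have := @blocks_not_cross B B' p p' n n' PB PB' ne Bp Bn Bp' Bn'.
  have := @blocks_not_cross B' B p' p n' n PB' PB (nesym ne) Bp' Bn' Bp Bn.
  have := fp _ Bn; have := fp' _ Bn'.
  by rewrite /apart; lia.
Qed.

Lemma arcs_of_admissible t u : arcs_of P t u -> admissible t u.
Proof.
rewrite /admissible.
by case=> [[B [n [p [_ _ [_ np _] [-> ->]]]]]|[B [n [q [_ [Bq Bn] fq _ [-> ->]]]]]];
  [|have := fq _ Bn]; lia.
Qed.

Lemma isolated_even_infinite x : isolated (arcs_of P) (2 * x) ->
  exists B, [/\ P B, infinite_set B & first_in B x].
Proof.
move=> ix; have [B PB Bx] := block_of x pP; exists B; split=> //.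
  move=> finB; have [[n Bn xn]|fx] := prev_in_or_first Bx.
    by case: (ix (2 * n + 1)) => + _; apply; left; exists B, n, x.
  have [M hM] := finite_bounded finB.
  have [|m [Bm _ _ mmax]] := @greatest_le B M x Bx; first by have := hM _ Bx; lia.
  case: (ix (2 * m + 1)) => _; apply; right; exists B, m, x; split=> // y By.
  by apply: mmax => //; have := hM _ By; lia.
have [[n Bn xn]|//] := prev_in_or_first Bx.
by case: (ix (2 * n + 1)) => + _; case; left; exists B, n, x.
Qed.

Lemma isolated_odd_infinite x : isolated (arcs_of P) (2 * x + 1) ->
  exists B, [/\ P B, infinite_set B & last_in B x].
Proof.
move=> ix; have [B PB Bx] := block_of x pP; exists B; split=> //.
  move=> finB; have [[p xp]|lx] := next_in_or_last B x.
    by case: (ix (2 * p)) => _; apply; left; exists B, x, p.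
  have [M hM] := finite_bounded finB.
  have [|m [Bm _ _ mmin]] := @least_ge B (- M) x Bx; first by have := hM _ Bx; lia.
  case: (ix (2 * m)) => + _; apply; right; exists B, x, m; split=> // y By.
  by apply: mmin => //; have := hM _ By; lia.
have [[p xp]|//] := next_in_or_last B x.
by case: (ix (2 * p)) => _; case; left; exists B, x, p.
Qed.

(** An admissible arc that could be added has isolated ends of opposite parity,
hence an infinite block with a least element and one with a greatest element;
these are equal, and then finite. *)
Lemma arcs_of_config : arc_config (arcs_of P).
Proof.
split=> [t u|t u adm]; first exact: arcs_of_admissible.
split=> [Atu a b Aab|ap]; first exact: arcs_of_apart.
apply: contrapT => nA.
have {}ap a b : arcs_of P a b -> apart a b t u.
  by move=> Aab; apply: ap => // -[e1 e2]; apply: nA; rewrite -e1 -e2.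
have lt_arc a b : arcs_of P a b -> b < a by move=> /arcs_of_admissible/andP[].
have ut : u < t by case/andP: adm.
have it : isolated (arcs_of P) t.
  by move=> y; split=> h; have := ap _ _ h; have := lt_arc _ _ h; rewrite /apart; lia.
have iu : isolated (arcs_of P) u.
  by move=> y; split=> h; have := ap _ _ h; have := lt_arc _ _ h; rewrite /apart; lia.
have no_both x y : isolated (arcs_of P) (2 * x) ->
    isolated (arcs_of P) (2 * y + 1) -> False.
  move=> /isolated_even_infinite[B [PB infB fx]].
  move=> /isolated_odd_infinite[B' [PB' infB' ly]].
  have BB' := infP PB PB' infB infB'; subst B'.
  by apply: infB; exact: bounded_finite fx ly.
have [] := admissible_ends adm => -[x [y [et eu]]]; subst t u.
  exact: no_both it iu.
exact: no_both iu it.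
Qed.

Lemma arcs_of_rule : arc_rule (arcs_of P) P.
Proof.
move=> B n PB Bn; split=> [m|noA].
  case=> [[B' [n' [p [PB' B'n np [-> e]]]]]|[B' [n' [q [_ _ _ _ [_ e]]]]]];
    last by lia.
  have {e}e : n = n' by lia.
  by subst n'; exists p => //; rewrite (block_eq pP PB PB' Bn B'n).
have [[p np]|//] := next_in_or_last B n.
by case: (noA (2 * p)); left; exists B, n, p.
Qed.

End ArcsOf.

(** * Translation to the triangulated category *)

Section Categorical.
Context {K : fieldType}.

Section Isomorphic.
Context {C : lincat K}.
Implicit Types x y z : C.

Lemma isomorphic_refl x : isomorphic x x.
Proof. by exists (idm x), (idm x); rewrite comp1m. Qed.

Lemma isomorphic_sym x y : isomorphic x y -> isomorphic y x.
Proof. by move=> [f [g [gf fg]]]; exists g, f. Qed.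

Lemma isomorphic_trans y x z : isomorphic x y -> isomorphic y z -> isomorphic x z.
Proof.
move=> [f [g [gf fg]]] [h [k [kh hk]]]; exists (h \oc f), (g \oc k); split.
  by rewrite compA -(compA g) kh compm1.
by rewrite compA -(compA h) fg compm1.
Qed.

Lemma comp0m x y z (f : Hom x y) : (0 : Hom y z) \oc f = 0.
Proof.
by have := comp_linl f (-1) (0 : Hom y z) 0; rewrite scaler0 addr0 scaleN1r addNr.
Qed.

Lemma compm0 x y z (g : Hom y z) : g \oc (0 : Hom x y) = 0.
Proof.
by have := comp_linr g (-1) (0 : Hom x y) 0; rewrite scaler0 addr0 scaleN1r addNr.
Qed.

(** Hom(x, y) = 0. *)
Definition hom_zero x y : Prop := forall f : Hom x y, f = 0.

Lemma hom_zero_iso x y x' y' : isomorphic x x' -> isomorphic y y' ->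
  hom_zero x y -> hom_zero x' y'.
Proof.
move=> [a [a' [aa' a'a]]] [b [b' [bb' b'b]]] h f.
rewrite -(compm1 f) -a'a -(comp1m f) -b'b.
by rewrite -(compA b) compA -(compA b) (h (b' \oc f \oc a)) compm0 comp0m.
Qed.

Lemma is_zero_iso x y : isomorphic x y -> is_zero x -> is_zero y.
Proof.
move=> [f [g [gf fg]]] x0.
by rewrite /is_zero -fg -(comp1m g) x0 comp0m compm0.
Qed.

Lemma indecomposable_iso x y : isomorphic x y -> indecomposable x -> indecomposable y.
Proof.
move=> xy [nzx indx]; split=> [/(is_zero_iso (isomorphic_sym xy))//|a b].
have [f [g [gf fg]]] := xy.
move=> [i1 [i2 [p1 [p2 [pi1 pi2 ip]]]]]; apply: indx.
exists (g \oc i1), (g \oc i2), (p1 \oc f), (p2 \oc f); split.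
- by rewrite compA -(compA p1) fg compm1.
- by rewrite compA -(compA p2) fg compm1.
have compD (u v : Hom x y) : g \oc (u + v) = g \oc u + g \oc v.
  by have := comp_linr g 1 u v; rewrite !scale1r.
have compDl (u v : Hom y y) : (u + v) \oc f = u \oc f + v \oc f.
  by have := comp_linl f 1 u v; rewrite !scale1r.
by rewrite -!(compA g) (compA i1) (compA i2) -compD -compDl ip comp1m.
Qed.

Lemma has_dim1_neq0 x y : has_dim (Hom x y) 1 -> ~ hom_zero x y.
Proof.
move=> [phi _ [psi phiK psiK]] h.
have : (1 : 'rV[K]_1) = 0 by rewrite -(psiK 1) -(psiK 0) !(h (psi _)).
by move/eqP; rewrite oner_eq0.
Qed.

End Isomorphic.

Lemma functor_isomorphic (C D : lincat K) (F : linfunctor C D) x y :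
  isomorphic x y -> isomorphic (F x) (F y).
Proof.
move=> [f [g [gf fg]]]; exists (fmor F f), (fmor F g).
by rewrite -!fmorM gf fg !fmor1.
Qed.

(** The isomorphism-closed collection of indecomposable objects whose arcs are
those of A. *)
Definition objects_of (T : triangulated K) (arc : int -> int -> T)
    (A : int -> int -> Prop) : set T :=
  [set x | exists t u, A t u /\ isomorphic (arc t u) x].

Context {T : triangulated K} {arc : int -> int -> T}.
Hypothesis model : arc_model arc.

Lemma unshift_arc t u : admissible t u ->
  isomorphic (unshift T (arc t u)) (arc (t + 1) (u + 1)).
Proof.
move=> tu; have tu1 : admissible (t + 1) (u + 1) by rewrite /admissible in tu *; lia.
have := arc_shift model tu1; rewrite !addrK => /isomorphic_sym sh.
apply: isomorphic_trans (functor_isomorphic (unshift T) sh) _.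
by have [eta [iso_eta _]] := shiftK T; exists (eta (arc (t + 1) (u + 1))).
Qed.

Lemma hom_zero_arc a b t u : admissible a b -> admissible t u ->
  hom_zero (arc a b) (arc t u) <-> ~ arc_hom a b t u.
Proof.
move=> ab tu; split=> [h0 h1|h0]; last exact: arc_hom0 h0.
exact: has_dim1_neq0 (arc_hom1 model ab tu h1) h0.
Qed.

Lemma hom_zero_apart a b t u : admissible a b -> admissible t u ->
  (forall i : int, i \in [:: 0; -1] -> hom_zero (arc a b) (shiftz i (arc t u))) <->
  apart a b t u.
Proof.
move=> ab tu; have tu1 : admissible (t + 1) (u + 1) by rewrite /admissible in tu *; lia.
have id := @isomorphic_refl T.
rewrite -arc_hom_apart // -!hom_zero_arc //; have su := unshift_arc tu.
split=> [h|[h0 h1] i].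
  split; first by apply: (h 0).
  by apply: hom_zero_iso (id _) su _; apply: (h (-1)).
rewrite !inE => /orP[]/eqP -> //.
exact: hom_zero_iso (id _) (isomorphic_sym su) h1.
Qed.

(** Distinct arcs are non-isomorphic objects. *)
Lemma arc_neq a b t u : admissible a b -> admissible t u ->
  (a, b) <> (t, u) <-> ~ isomorphic (arc a b) (arc t u).
Proof.
move=> ab tu; split=> ne; first by move=> /(arc_inj model ab tu).
by move=> [e1 e2]; apply: ne; rewrite e1 e2; exact: isomorphic_refl.
Qed.

Lemma config_of_objects H : hom_configuration_m1 H -> arc_config (has_arc arc H).
Proof.
move=> [isoH indH maxH]; split=> [t u []//|t u tu].
have [mx1 mx2] := maxH _ (arc_indec model tu).
split=> [[_ Htu] a b [ab Hab] ne|ap].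
  apply/(hom_zero_apart ab tu) => i i01.
  by apply: mx1 => //; exact/arc_neq.
split=> //; apply: mx2 => x Hx nx i i01.
have [a [b [ab abx]]] := arc_surj model (indH _ Hx).
have Hab : H (arc a b) by exact: isoH (isomorphic_sym abx) Hx.
suff h0 : hom_zero (arc a b) (shiftz i (arc t u)).
  by apply: hom_zero_iso abx (isomorphic_refl _) h0.
apply: (proj2 (hom_zero_apart ab tu)) => //; apply: ap => //.
apply/arc_neq => // abtu; apply: nx.
exact: isomorphic_trans (isomorphic_sym abx) abtu.
Qed.

Lemma shiftz_iso (i : int) x y : i \in [:: 0; -1] -> isomorphic x y ->
  isomorphic (shiftz i x) (shiftz i (y : T)).
Proof.
rewrite !inE => /orP[]/eqP -> //= xy.
exact: (functor_isomorphic (unshift T)).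
Qed.

Lemma objects_of_config A : arc_config A -> hom_configuration_m1 (objects_of arc A).
Proof.
move=> cA; split=> [x y xy [t [u [Atu tux]]]|x [t [u [Atu tux]]]|h indh].
- by exists t, u; split=> //; exact: isomorphic_trans tux xy.
- exact: indecomposable_iso tux (arc_indec model (cA.1 _ _ Atu)).
have [t [u [tu tuh]]] := arc_surj model indh.
split=> [[t' [u' [Atu tuh']]] x [a [b [Aab abx]]] nx i i01|mx].
  have tu' := cA.1 _ _ Atu; have ab := cA.1 _ _ Aab.
  apply: (hom_zero_iso abx (shiftz_iso i01 tuh')).
  apply: (proj2 (hom_zero_apart ab tu')) => //.
  apply: (proj1 (cA.2 _ _ tu') Atu _ _ Aab) => -[e1 e2]; apply: nx; subst a b.
  exact: isomorphic_trans (isomorphic_sym abx) tuh'.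
exists t, u; split=> //; apply/(cA.2 t u tu) => a b Aab ne.
have ab := cA.1 _ _ Aab.
apply/(hom_zero_apart ab tu) => i i01.
apply: hom_zero_iso (isomorphic_refl _) (shiftz_iso i01 (isomorphic_sym tuh)) _.
apply: mx => //; first by exists a, b; split=> //; exact: isomorphic_refl.
move=> abh; move/(arc_neq ab tu): ne; apply.
exact: isomorphic_trans abh (isomorphic_sym tuh).
Qed.

Lemma has_arc_objects_of A t u : arc_config A ->
  has_arc arc (objects_of arc A) t u <-> A t u.
Proof.
move=> cA; split=> [[tu [a [b [Aab]]]]|Atu].
  by move=> /(arc_inj model (cA.1 _ _ Aab) tu)[<- <-].
by split; [exact: cA.1 Atu|exists t, u; split=> //; exact: isomorphic_refl].
Qed.

Lemma objects_of_has_arc H : hom_configuration_m1 H -> objects_of arc (has_arc arc H) = H.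
Proof.
move=> [isoH indH _]; apply/seteqP; split=> x.
  by move=> [t [u [[_ Htu] tux]]]; exact: isoH tux Htu.
move=> Hx; have [t [u [tu tux]]] := arc_surj model (indH _ Hx).
by exists t, u; split=> //; split=> //; exact: isoH (isomorphic_sym tux) Hx.
Qed.

Lemma f_map_spec H : hom_configuration_m1 H ->
  int_partition (f_map arc H) /\ arc_rule (has_arc arc H) (f_map arc H).
Proof.
move=> cH.
exact: (@xgetPex _ set0 [set P | int_partition P /\ block_rule arc H P])
  (arc_rule_exists (config_of_objects cH)).
Qed.

End Categorical.

Theorem proposition7p2 (K : closedFieldType) (T : triangulated K)
    (arc : int -> int -> T) :
  is_T_m1 T -> arc_model arc ->
  set_bij [set H : set T | hom_configuration_m1 H]
    [set P : set (set int) |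
      [/\ int_partition P, noncrossing P & at_most_one_infinite_block P]]
    (f_map arc).
Proof.
move=> _ model; split.
- move=> H /= cH; have [pP rP] := f_map_spec model cH.
  have cA := config_of_objects model cH.
  split=> //; first exact (config_noncrossing cA pP rP).
  exact (config_one_infinite cA pP rP).
- move=> H H'; rewrite !inE => cH cH' eqf.
  have [pP rP] := f_map_spec model cH; have [_ rP'] := f_map_spec model cH'.
  rewrite -(objects_of_has_arc model cH) -(objects_of_has_arc model cH').
  congr (objects_of arc _); apply/funext => t; apply/funext => u; apply/propext.
  rewrite -eqf in rP'.
  have cA' := config_of_objects model cH'.
  exact: (arc_config_inj (config_of_objects model cH) cA' pP rP rP').
- move=> P /= [pP nc inf].
  have cA := arcs_of_config pP nc inf.
  have cH := objects_of_config model cA.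
  exists (objects_of arc (arcs_of P)) => //.
  have [pf rf] := f_map_spec model cH.
  have eqA : has_arc arc (objects_of arc (arcs_of P)) = arcs_of P.
    apply/funext => t; apply/funext => u; apply/propext.
    exact: has_arc_objects_of.
  apply: (block_rule_uniq pf pP rf).
  by rewrite /block_rule eqA; exact: arcs_of_rule.
Qed.
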